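(* Consider a rectangle $\mathcal{R}\subset\mathbb{C}$ with legs measuring $r_1,r_2>0$, set $R=r_1+\sqrt{-1}\,r_2$, and denote the vertices of $\mathcal{R}$, in anticlockwise order, by $P_0,P_1,P_2,P_3\in\mathbb{C}$ (with $|P_1-P_0|=r_1$ and $|P_3-P_0|=r_2$). Let $L=i+\sqrt{-1}\,j$, and let $\varphi_0,\varphi_1,\varphi_2,\varphi_3$ be any four elements of $\mathbb{H}_{\mathbb{C}}$. Then there exists a degree one polynomial $A\in\mathbb{H}_{\mathbb{C}}[z]$ such that $\Phi(z)=A(z)LA(z)^c$ satisfies $\Phi(P_\ell)=\varphi_\ell$ for $\ell=0,1,2,3$ if and only if the following conditions are satisfied: $$\varphi_\ell+\varphi_\ell^c=\varphi_\ell\varphi_\ell^c=0\quad\text{for }\ell=0,1,2,3;$$ $$|R|^2\varphi_0+R^2\varphi_1-|R|^2\varphi_2-R^2\varphi_3=0;$$ $$\operatorname{cr}(P_0,P_1,P_2,P_3)=\operatorname{cr}(\varphi_0,\varphi_1,\varphi_2,\varphi_3).$$ Here $\operatorname{cr}$ denotes a cross-ratio: on the left-hand side it is the cross-ratio of four complex numbers, and on the right-hand side it is the cross-ratio of four points on the projective conic $\mathcal{N}$ of vectorial complex quaternions of zero norm.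
   Context: $\mathbb{H}_{\mathbb{C}}=\mathbb{H}\otimes_{\mathbb{R}}\mathbb{C}$ is the algebra of complex quaternions: elements are $z_0+z_1i+z_2j+z_3k$ with $z_\ell\in\mathbb{C}$, where $i^2=j^2=k^2=-1$, $ij=-ji=k$, and the complex imaginary unit $\sqrt{-1}$ is central (distinct from $i$). The conjugate is $(z_0+z_1i+z_2j+z_3k)^c=z_0-z_1i-z_2j-z_3k$. $\mathbb{H}_{\mathbb{C}}[z]$ is the ring of polynomials with coefficients in $\mathbb{H}_{\mathbb{C}}$ in an indeterminate $z$ commuting with the coefficients, evaluated at complex numbers; $A(z)^c$ is obtained by conjugating the coefficients of $A$. $\mathcal{N}$ is the conic $z_1^2+z_2^2+z_3^2=0$ in the projective plane of vectorial complex quaternions $z_1i+z_2j+z_3k$. The first condition says that the vectors $\varphi_0,\varphi_1,\varphi_2,\varphi_3$ define points on $\mathcal{N}$. The conic $\mathcal{N}$ is parametrized by $\mathbb{P}^1(\mathbb{C})$ via $$[s:t]\mapsto N(s,t)=(s^2+t^2)i+\sqrt{-1}(s^2-t^2)j+2\sqrt{-1}\,st\,k,$$ and the cross-ratio of four points on $\mathcal{N}$ is the cross-ratio of their parameters $[s_\ell:t_\ell]\in\mathbb{P}^1(\mathbb{C})$; the same cross-ratio convention is used on both sides of the last condition.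
   Formalization: The vectors φ_0,…,φ_3 are additionally assumed not to be all multiples of a single vector; otherwise (e.g. all zero or all equal) a suitable A can exist although the cross-ratio of the φ_ℓ is undefined. *)

(* Defs.v *)
From HB Require Import structures.
From mathcomp Require Import all_boot all_order all_algebra.
From mathcomp Require Import complex.
From mathcomp Require Import reals.
From mathcomp Require Import ring.

Set Implicit Arguments.
Unset Strict Implicit.
Unset Printing Implicit Defensive.

Import Order.TTheory GRing.Theory Num.Theory.
Local Open Scope ring_scope.

(* [Quat z0 z1 z2 z3] is z0 + z1 i + z2 j + z3 k. The complex quaternions are
   [quat R[i]]; the complex imaginary unit is the scalar ['i%C], and a complex
   number z is embedded in the centre as [z%:A]. *)
Record quat (K : Type) := Quat { qr : K; qi : K; qj : K; qk : K }.

Section QuatChoice.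
Variable K : choiceType.

Definition tuple_of_quat (a : quat K) := (qr a, qi a, qj a, qk a).
Definition quat_of_tuple (t : K * K * K * K) :=
  let: (a, b, c, d) := t in Quat a b c d.

Lemma tuple_of_quatK : cancel tuple_of_quat quat_of_tuple.
Proof. by case. Qed.

HB.instance Definition _ := Choice.copy (quat K) (can_type tuple_of_quatK).
End QuatChoice.

Section QuatRing.
Variable K : comNzRingType.
Implicit Types a b c : quat K.

Definition addq a b := Quat (qr a + qr b) (qi a + qi b) (qj a + qj b) (qk a + qk b).
Definition oppq a := Quat (- qr a) (- qi a) (- qj a) (- qk a).

Lemma addqA : associative addq.
Proof. by move=> a b c; rewrite /addq /= !addrA. Qed.
Lemma addqC : commutative addq.
Proof. by move=> a b; congr Quat; exact: addrC. Qed.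
Lemma add0q : left_id (Quat 0 0 0 0) addq.
Proof. by case=> *; rewrite /addq /= !add0r. Qed.
Lemma addNq : left_inverse (Quat 0 0 0 0) oppq addq.
Proof. by move=> a; rewrite /addq /= !addNr. Qed.

HB.instance Definition _ :=
  GRing.isZmodule.Build (quat K) addqA addqC add0q addNq.

Definition mulq a b := Quat
  (qr a * qr b - qi a * qi b - qj a * qj b - qk a * qk b)
  (qr a * qi b + qi a * qr b + qj a * qk b - qk a * qj b)
  (qr a * qj b - qi a * qk b + qj a * qr b + qk a * qi b)
  (qr a * qk b + qi a * qj b - qj a * qi b + qk a * qr b).

Lemma mulqA : associative mulq.
Proof. by move=> a b c; congr Quat => /=; ring. Qed.
Lemma mul1q : left_id (Quat 1 0 0 0) mulq.
Proof. by case=> *; congr Quat => /=; ring. Qed.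
Lemma mulq1 : right_id (Quat 1 0 0 0) mulq.
Proof. by case=> *; congr Quat => /=; ring. Qed.
Lemma mulqDl : left_distributive mulq +%R.
Proof. by move=> a b c; congr Quat => /=; ring. Qed.
Lemma mulqDr : right_distributive mulq +%R.
Proof. by move=> a b c; congr Quat => /=; ring. Qed.
Lemma oneq_neq0 : Quat 1 0 0 0 != 0 :> quat K.
Proof. by apply/eqP => -[] /eqP; rewrite oner_eq0. Qed.

HB.instance Definition _ := GRing.Zmodule_isNzRing.Build (quat K)
  mulqA mul1q mulq1 mulqDl mulqDr oneq_neq0.

Definition scaleq (z : K) a := Quat (z * qr a) (z * qi a) (z * qj a) (z * qk a).

Lemma scaleqA z w a : scaleq z (scaleq w a) = scaleq (z * w) a.
Proof. by congr Quat => /=; ring. Qed.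
Lemma scale1q : left_id 1 scaleq.
Proof. by case=> *; congr Quat => /=; ring. Qed.
Lemma scaleqDr : right_distributive scaleq +%R.
Proof. by move=> z a b; congr Quat => /=; ring. Qed.
Lemma scaleqDl a : {morph scaleq^~ a : z w / z + w}.
Proof. by move=> z w; congr Quat => /=; ring. Qed.

HB.instance Definition _ := GRing.Zmodule_isLmodule.Build K (quat K)
  scaleqA scale1q scaleqDr scaleqDl.

Lemma scaleqAl z a b : z *: (a * b) = (z *: a) * b.
Proof. by congr Quat => /=; ring. Qed.
HB.instance Definition _ := GRing.Lmodule_isLalgebra.Build K (quat K) scaleqAl.

Lemma scaleqAr z a b : z *: (a * b) = a * (z *: b).
Proof. by congr Quat => /=; ring. Qed.
HB.instance Definition _ := GRing.Lalgebra_isAlgebra.Build K (quat K) scaleqAr.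

Definition conjq a := Quat (qr a) (- qi a) (- qj a) (- qk a).

Lemma conjq_is_zmod_morphism : zmod_morphism conjq.
Proof. by move=> a b; congr Quat => /=; ring. Qed.
HB.instance Definition _ :=
  GRing.isZmodMorphism.Build (quat K) (quat K) conjq conjq_is_zmod_morphism.

Definition quat_i : quat K := Quat 0 1 0 0.
Definition quat_j : quat K := Quat 0 0 1 0.
Definition quat_k : quat K := Quat 0 0 0 1.
End QuatRing.

Arguments quat_i {K}.
Arguments quat_j {K}.
Arguments quat_k {K}.

Section CrossRatio.
Variable R : realType.
Local Notation C := (complex R).

(* Vertices P 0, P 1, P 2, P 3 of a rectangle: P 1 - P 0 and P 3 - P 0 span a
   parallelogram, are orthogonal as vectors of the real plane, and form a
   positively oriented basis (in particular both are nonzero). *)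
Definition anticlockwise_rectangle (P : 'I_4 -> C) :=
  let u := P 1 - P 0 in let v := P 3 - P 0 in
  [/\ P 2 = P 0 + u + v, complex.Re u * complex.Re v + complex.Im u * complex.Im v = 0
    & 0 < complex.Re u * complex.Im v - complex.Im u * complex.Re v].

(* A pair (s, t) != (0, 0) stands for the point [s : t] of the projective line;
   a complex number z is the point [z : 1]. *)
Definition bracket (p q : C * C) : C := p.1 * q.2 - q.1 * p.2.

Definition cross_ratio_num (p : 'I_4 -> C * C) : C :=
  bracket (p 0) (p 2) * bracket (p 1) (p 3).
Definition cross_ratio_den (p : 'I_4 -> C * C) : C :=
  bracket (p 1) (p 2) * bracket (p 0) (p 3).
Definition cross_ratio (p : 'I_4 -> C * C) : C :=
  cross_ratio_num p / cross_ratio_den p.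

Lemma cross_ratio_affine (P : 'I_4 -> C) :
  cross_ratio (fun l => (P l, 1)) =
  ((P 0 - P 2) * (P 1 - P 3)) / ((P 1 - P 2) * (P 0 - P 3)).
Proof. by rewrite /cross_ratio /cross_ratio_num /cross_ratio_den /bracket /= !mulr1. Qed.

Definition conic_param (p : C * C) : quat C :=
  (p.1 ^+ 2 + p.2 ^+ 2) *: quat_i + ('i%C * (p.1 ^+ 2 - p.2 ^+ 2)) *: quat_j
  + (2 * 'i%C * p.1 * p.2) *: quat_k.

(* The vector [phi] defines a point of the conic, namely the one with
   parameter [s : t] = [p.1 : p.2]. *)
Definition conic_point (phi : quat C) (p : C * C) :=
  p != (0, 0) /\ exists2 c : C, c != 0 & phi = c *: conic_param p.

(* The four vectors define points of the conic whose cross-ratio is the finite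
   number [x]. The cross-ratio of [p 0], ..., [p 3] is defined and finite exactly
   when [cross_ratio_den p != 0]: then no three of the points coincide. It does
   not depend on the choice of the homogeneous coordinates [p]. *)
Definition conic_cross_ratio (phi : 'I_4 -> quat C) (x : C) :=
  exists p : 'I_4 -> C * C,
    [/\ forall l, conic_point (phi l) (p l),
        cross_ratio_den p != 0 & cross_ratio p = x].

(* When the vectors are all multiples of one vector, they define at most one
   point, and no cross-ratio: such vectors are interpolated by some degenerate
   A (if v is isotropic and phi l = f(P l)^2 v with f of degree at most one), but
   not by all those satisfying the other two conditions of the theorem. *)
Definition all_proportional (phi : 'I_4 -> quat C) :=
  exists v : quat C, forall l, exists c : C, phi l = c *: v.

Definition quatL : quat C := quat_i + 'i%C *: quat_j.

(* A(z) L A(z)^c, as a polynomial. *)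
Definition isotropic_poly (A : {poly quat C}) : {poly quat C} :=
  A * quatL%:P * map_poly (@conjq C) A.

End CrossRatio.
Arguments quatL {R}.

(* Main.v *)
(** With N the parametrization of the conic, one has A L A^c = N(x, y) for
    x = a0 - sqrt(-1) a3 and y = a1 + sqrt(-1) a2. So phi is interpolated by a
    linear A exactly when some affine map u(z) = a + z b into C^2 satisfies
    N(u(P_l)) = phi_l. Normalizing the vertices to 0, r1, rho, sqrt(-1) r2, the
    three conditions hold for such a map by computation. Conversely, write
    phi_l = N(p_l), each p_l being determined up to sign. Polarizing the linear
    relation against the square of each p_l gives linear equations between the
    squares of the brackets [p_k, p_l]; the cross-ratio and the Pluecker relation
    select one of their solutions, for which the signs of the p_l can be chosen
    so that the p_l are the values of an affine map. *)
Require Import Defs.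
From mathcomp Require Import all_boot all_order all_algebra.
From mathcomp Require Import complex.
From mathcomp Require Import reals.
From mathcomp Require Import ring.

Set Implicit Arguments.
Unset Strict Implicit.
Unset Printing Implicit Defensive.

Import Order.TTheory GRing.Theory Num.Theory.
Local Open Scope ring_scope.

(** * Bracket algebra in a plane over a field *)

Section Brackets.
Variables (F : fieldType) (i r1 r2 rho rhob : F).
Hypotheses (sqi : i ^+ 2 = -1) (two_neq0 : 2 != 0 :> F).
Hypotheses (r1_neq0 : r1 != 0) (r2_neq0 : r2 != 0).
Hypotheses (rhoE : rho = r1 + i * r2) (rhobE : rhob = r1 - i * r2).
Hypotheses (rho_neq0 : rho != 0) (rhob_neq0 : rhob != 0).

Lemma rhoM : rho * rhob = r1 ^+ 2 + r2 ^+ 2.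
Proof. by rewrite rhoE rhobE; ring: sqi. Qed.

(** The first four hypotheses are the relation polarized at each of the points. They force the
    squared brackets of opposite sides to agree; the Plücker relation and the cross-ratio then fix
    the ratio of adjacent ones. *)
Lemma sqr_brackets (b01 b02 b03 b12 b13 b23 : F) :
  rho * (b01 ^+ 2 - b03 ^+ 2) - rhob * b02 ^+ 2 = 0 ->
  rhob * (b01 ^+ 2 - b12 ^+ 2) - rho * b13 ^+ 2 = 0 ->
  rhob * b02 ^+ 2 + rho * b12 ^+ 2 - rho * b23 ^+ 2 = 0 ->
  rhob * b03 ^+ 2 + rho * b13 ^+ 2 - rhob * b23 ^+ 2 = 0 ->
  b01 * b23 - b02 * b13 + b03 * b12 = 0 ->
  r2 ^+ 2 * (b02 * b13) = rho * rhob * (b12 * b03) ->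
  b12 * b03 != 0 ->
  [/\ b12 ^+ 2 = b03 ^+ 2, r1 ^+ 2 * b03 ^+ 2 = - (r2 ^+ 2 * b01 ^+ 2)
    & r1 ^+ 2 * b02 ^+ 2 = rho ^+ 2 * b01 ^+ 2].
Proof.
move=> h0 h1 h2 h3 pl cr ne0.
have eq0 (c x y : F) : c != 0 -> c * (x - y) = 0 -> x = y.
  by move=> c0 /eqP; rewrite mulf_eq0 (negPf c0) subr_eq0 => /eqP.
have eX : b01 ^+ 2 = b23 ^+ 2.
  apply: (eq0 (2 * (rho * rhob))); first by rewrite !mulf_neq0.
  transitivity (rhob * ((rho * (b01 ^+ 2 - b03 ^+ 2) - rhob * b02 ^+ 2)
                     + (rhob * b02 ^+ 2 + rho * b12 ^+ 2 - rho * b23 ^+ 2))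
           + rho * ((rhob * (b01 ^+ 2 - b12 ^+ 2) - rho * b13 ^+ 2)
                     + (rhob * b03 ^+ 2 + rho * b13 ^+ 2 - rhob * b23 ^+ 2))).
    by ring.
  by rewrite h0 h1 h2 h3; ring.
have eY : b12 ^+ 2 = b03 ^+ 2.
  apply: (eq0 rho) => //.
  transitivity ((rho * (b01 ^+ 2 - b03 ^+ 2) - rhob * b02 ^+ 2)
                     + (rhob * b02 ^+ 2 + rho * b12 ^+ 2 - rho * b23 ^+ 2)).
    by rewrite eX; ring.
  by rewrite h0 h2 addr0.
have b03_neq0 : b03 != 0.
  by move: ne0; rewrite mulf_eq0 negb_or => /andP[].
(* The Plücker relation eliminates [b02 * b13] from the cross-ratio. Squaring the result leaves
   [r2 ^+ 2 * b01 ^+ 2 = r1 ^+ 2 * b03 ^+ 2] up to sign. *)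
have e4 : r2 ^+ 4 * (b01 ^+ 2) ^+ 2 = r1 ^+ 4 * (b03 ^+ 2) ^+ 2.
  have e : r2 ^+ 2 * (b01 * b23) = r1 ^+ 2 * (b12 * b03).
    rewrite -[LHS]subr0 -(mulr0 (r2 ^+ 2)) -pl.
    transitivity (r2 ^+ 2 * (b02 * b13) - r2 ^+ 2 * (b12 * b03)); first by ring.
    by rewrite cr rhoM; ring.
  transitivity ((r2 ^+ 2 * (b01 * b23)) ^+ 2); first by rewrite {1}expr2 {2}eX; ring.
  by rewrite e exprMn [(b12 * _) ^+ 2]exprMn eY; ring.
(* The product of [h0] and [h1], compared with the squared cross-ratio, will decide the sign. *)
have k4 : r2 ^+ 4 * (b01 ^+ 2 - b03 ^+ 2) ^+ 2
        = (r1 ^+ 2 + r2 ^+ 2) ^+ 2 * (b03 ^+ 2) ^+ 2.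
  have e02 : rhob * b02 ^+ 2 = rho * (b01 ^+ 2 - b03 ^+ 2).
    by apply/esym/subr0_eq.
  have e13 : rho * b13 ^+ 2 = rhob * (b01 ^+ 2 - b03 ^+ 2).
    by apply/esym/subr0_eq; rewrite -h1 eY.
  have ne : rho * rhob != 0 by rewrite mulf_neq0.
  apply: (mulfI ne).
  transitivity (r2 ^+ 4 * ((rhob * b02 ^+ 2) * (rho * b13 ^+ 2))).
    by rewrite e02 e13; ring.
  transitivity (rho * rhob * (r2 ^+ 2 * (b02 * b13)) ^+ 2); first by ring.
  by rewrite cr rhoM exprMn [(b12 * _) ^+ 2]exprMn eY; ring.
have main : r1 ^+ 2 * b03 ^+ 2 = - (r2 ^+ 2 * b01 ^+ 2).
  apply/eqP; rewrite -addr_eq0.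
  have /eqP : (r2 ^+ 2 * b01 ^+ 2 - r1 ^+ 2 * b03 ^+ 2)
      * (r1 ^+ 2 * b03 ^+ 2 + r2 ^+ 2 * b01 ^+ 2) = 0.
    transitivity (r2 ^+ 4 * (b01 ^+ 2) ^+ 2 - r1 ^+ 4 * (b03 ^+ 2) ^+ 2); first by ring.
    by rewrite e4 subrr.
  (* With the plus sign, [k4] would identify the squares of [r1 ^+ 2 + r2 ^+ 2] and
     [r1 ^+ 2 - r2 ^+ 2], which differ by [4 * r1 ^+ 2 * r2 ^+ 2]. *)
  rewrite mulf_eq0 => /orP[|//]; rewrite subr_eq0 => /eqP e.
  have /eqP : 2 ^+ 2 * (r1 ^+ 2 * r2 ^+ 2) * (b03 ^+ 2) ^+ 2 = 0.
    transitivity ((r1 ^+ 2 + r2 ^+ 2) ^+ 2 * (b03 ^+ 2) ^+ 2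
      - (r1 ^+ 2 * b03 ^+ 2 - r2 ^+ 2 * b03 ^+ 2) ^+ 2); first by ring.
    by rewrite -e -k4; ring.
  by apply: contraTT => _; rewrite !mulf_neq0 ?expf_neq0.
split=> //.
apply: (mulfI rhob_neq0).
transitivity (r1 ^+ 2 * (rhob * b02 ^+ 2)); first by ring.
rewrite (_ : rhob * _ = rho * (b01 ^+ 2 - b03 ^+ 2)); last by apply/esym/subr0_eq.
transitivity (rho * (r1 ^+ 2 * b01 ^+ 2 - r1 ^+ 2 * b03 ^+ 2)); first by ring.
rewrite main; transitivity (rho * (r1 ^+ 2 + r2 ^+ 2) * b01 ^+ 2); first by ring.
by rewrite -rhoM; ring.
Qed.

Let det (p q : F * F) : F := p.1 * q.2 - q.1 * p.2.
(** This triple determines [p] up to sign, and [conic_param] is linear in it. *)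
Definition veronese (p : F * F) := (p.1 ^+ 2, p.2 ^+ 2, p.1 * p.2).
Definition line_point (a b : F * F) (z : F) := (a.1 + z * b.1, a.2 + z * b.2).

Lemma veronese_sign e p q : e ^+ 2 = 1 ->
  e * p.1 = q.1 -> e * p.2 = q.2 -> veronese p = veronese q.
Proof.
by move=> e2 h1 h2; rewrite /veronese -h1 -h2; do 2?congr (_, _); ring: e2.
Qed.

(** Evaluating the relation at [p0], ..., [p3] feeds [sqr_brackets], whose conclusions say exactly
    that the required rescaling factors are signs. *)
Lemma interpolate_up_to_sign (p0 p1 p2 p3 : F * F) :
  (forall q, rhob * det p0 q ^+ 2 + rho * det p1 q ^+ 2
     - rhob * det p2 q ^+ 2 - rho * det p3 q ^+ 2 = 0) ->
  r2 ^+ 2 * (det p0 p2 * det p1 p3) = rho * rhob * (det p1 p2 * det p0 p3) ->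
  det p1 p2 * det p0 p3 != 0 ->
  exists a b : F * F,
    [/\ veronese p0 = veronese a, veronese p1 = veronese (line_point a b r1),
        veronese p2 = veronese (line_point a b rho)
      & veronese p3 = veronese (line_point a b (i * r2))].
Proof.
move=> rel cr ne0.
have pl : det p0 p1 * det p2 p3 - det p0 p2 * det p1 p3 + det p0 p3 * det p1 p2 = 0.
  by rewrite /det; ring.
have [eY main e02] : [/\ det p1 p2 ^+ 2 = det p0 p3 ^+ 2,
    r1 ^+ 2 * det p0 p3 ^+ 2 = - (r2 ^+ 2 * det p0 p1 ^+ 2)
  & r1 ^+ 2 * det p0 p2 ^+ 2 = rho ^+ 2 * det p0 p1 ^+ 2].
  apply: sqr_brackets pl cr ne0.
  - by rewrite -(rel p0) /det; ring.
  - by rewrite -(rel p1) /det; ring.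
  - by rewrite -(rel p2) /det; ring.
  - by rewrite -(rel p3) /det; ring.
have div_sqr1 (x y : F) : y != 0 -> x ^+ 2 = y ^+ 2 -> (x / y) ^+ 2 = 1.
  by move=> y0 e; rewrite expr_div_n e divff // expf_eq0.
have i_neq0 : i != 0 by rewrite -sqrf_eq0 sqi oppr_eq0 oner_eq0.
move: (ne0); rewrite mulf_eq0 negb_or => /andP[n12 n03].
have n01 : det p0 p1 != 0.
  have : r1 ^+ 2 * det p0 p3 ^+ 2 != 0 by rewrite mulf_eq0 !sqrf_eq0 negb_or r1_neq0.
  by rewrite main oppr_eq0 mulf_eq0 !sqrf_eq0 negb_or => /andP[].
have n02 : det p0 p2 != 0.
  have : rho ^+ 2 * det p0 p1 ^+ 2 != 0 by rewrite mulf_eq0 !sqrf_eq0 negb_or rho_neq0.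
  by rewrite -e02 mulf_eq0 !sqrf_eq0 negb_or => /andP[].
(* The brackets of the values u0, u1, u2, u3 of an affine map at 0, r1, rho, i * r2
   are [u0, u1] = r1 D, [u0, u2] = rho D, [u0, u3] = [u1, u2] = i r2 D. Taking
   u0 = e0 p0, u1 = p1, u2 = e2 p2, u3 = e3 p3 forces the following signs. *)
pose e0 := rho * det p1 p2 / (i * r2 * det p0 p2).
pose e2 := rho * det p0 p1 / (r1 * det p0 p2).
pose e3 := i * r2 * det p0 p1 / (r1 * det p0 p3).
have e0E : e0 ^+ 2 = 1.
  apply: div_sqr1; first by rewrite !mulf_neq0.
  have r1sq : r1 ^+ 2 != 0 by rewrite expf_neq0.
  apply: (mulfI r1sq).
  transitivity (rho ^+ 2 * (r1 ^+ 2 * det p1 p2 ^+ 2)); first by ring.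
  rewrite eY main.
  transitivity (- r2 ^+ 2 * (r1 ^+ 2 * det p0 p2 ^+ 2)); first by rewrite e02; ring.
  by ring: sqi.
have e2E : e2 ^+ 2 = 1.
  by apply: div_sqr1; [rewrite mulf_neq0 | rewrite !exprMn e02].
have e3E : e3 ^+ 2 = 1.
  apply: div_sqr1; first by rewrite mulf_neq0.
  by rewrite !exprMn main sqi; ring.
(* The affine map with value [e0 p0] at 0 and [p1] at [r1]. Its values at the other two nodes follow
   from the linear dependence of three plane vectors, with brackets as coefficients. *)
exists (e0 * p0.1, e0 * p0.2), ((p1.1 - e0 * p0.1) / r1, (p1.2 - e0 * p0.2) / r1).
have i0 : i * r2 != 0 by rewrite mulf_neq0.
have key2 x0 x1 x2 : x2 * det p0 p1 = - x0 * det p1 p2 + x1 * det p0 p2 ->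
    e2 * x2 = e0 * x0 + rho * ((x1 - e0 * x0) / r1).
  move=> h; rewrite /e2 mulrAC -[_ * x2]mulrA [det p0 p1 * x2]mulrC h.
  by rewrite /e0 rhoE; field: sqi; rewrite r1_neq0 n02 r2_neq0 i_neq0.
have key3 x0 x1 x3 : x3 * det p0 p1 = - x0 * det p1 p3 + x1 * det p0 p3 ->
    e3 * x3 = e0 * x0 + (i * r2) * ((x1 - e0 * x0) / r1).
  (* The cross-ratio eliminates the one bracket that [e0] and [e3] do not control. *)
  have -> : det p1 p3 = rho * rhob * (det p1 p2 * det p0 p3) / (r2 ^+ 2 * det p0 p2).
    by rewrite -cr; field; rewrite n02 r2_neq0.
  move=> h; rewrite /e3 mulrAC -[_ * x3]mulrA [det p0 p1 * x3]mulrC h.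
  by rewrite /e0 rhobE rhoE; field: sqi; rewrite r1_neq0 n02 r2_neq0 i_neq0 n03.
split.
- exact: (@veronese_sign e0).
- by apply: (@veronese_sign 1) => /=; rewrite ?expr1n //; field.
- by apply: (@veronese_sign e2) => //=; apply: key2; rewrite /det; ring.
- by apply: (@veronese_sign e3) => //=; apply: key3; rewrite /det; ring.
Qed.
End Brackets.

Lemma forall_ord4 (Q : 'I_4 -> Prop) : Q 0 -> Q 1 -> Q 2 -> Q 3 -> forall l, Q l.
Proof.
move=> Q0 Q1 Q2 Q3 l.
have [->|->|->|->] // : [\/ l = 0, l = 1, l = 2 | l = 3].
by case: l => [[|[|[|[|//]]]] ?];
  [constructor 1 | constructor 2 | constructor 3 | constructor 4]; apply: val_inj.
Qed.

(** * Evaluation at complex numbers and the parametrized conic *)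

Section Interpolation.
Variable R : realType.
Local Notation C := (complex R).
Implicit Types (a b : quat C) (p q : C * C) (z : C).

Let sqi : 'i%C ^+ 2 = -1 :> C := sqr_i R.

Lemma conic_paramE p : conic_param p =
  Quat 0 (p.1 ^+ 2 + p.2 ^+ 2) ('i%C * (p.1 ^+ 2 - p.2 ^+ 2)) (2 * 'i%C * (p.1 * p.2)).
Proof. by congr Quat => /=; ring. Qed.

Lemma conic_param_veronese p q :
  veronese p = veronese q -> conic_param p = conic_param q.
Proof. by rewrite !conic_paramE => -[-> -> ->]. Qed.

(** Writing this pair as (x, y), the product [a * quatL] has coordinates -y, x, ['i] x, ['i] y, so
    it depends on [a] only through the pair. *)
Definition spinor a : C * C := (qr a - 'i%C * qk a, qi a + 'i%C * qj a).

Lemma mul_quatL_conj a : a * quatL * conjq a = conic_param (spinor a).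
Proof. by rewrite conic_paramE; congr Quat => /=; ring: sqi. Qed.

Lemma spinor_line a b z :
  spinor (a + z *: b) = line_point (spinor a) (spinor b) z.
Proof. by congr (_, _) => /=; ring. Qed.

Lemma mul_scalarq z a : a * z%:A = z *: a.
Proof. by rewrite -scalerAr mulr1. Qed.

(** Evaluation over a noncommutative ring is not multiplicative in general; this commutation makes
    it so at complex scalars. *)
Lemma comm_poly_scalarq (A : {poly quat C}) z : comm_poly A z%:A.
Proof. by rewrite /comm_poly mul_scalarq -scalerAl mul1r. Qed.

Lemma horner_conj (A : {poly quat C}) z :
  (map_poly (@conjq C) A).[z%:A] = conjq A.[z%:A].
Proof.
(* A bound on the size of the conjugated polynomial suffices to align the two sums. *)
rewrite (@horner_coef_wide _ (size A)); last first.
  by rewrite map_polyE (leq_trans (size_Poly _)) ?size_map.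
rewrite horner_coef raddf_sum; apply: eq_bigr => k _.
rewrite coef_map_id0 ?raddf0 // exprZn expr1n !mul_scalarq.
by congr Quat => /=; ring.
Qed.

Lemma horner_isotropic (A : {poly quat C}) z :
  (isotropic_poly A).[z%:A] = conic_param (spinor A.[z%:A]).
Proof.
rewrite /isotropic_poly !hornerM_comm; try exact: comm_poly_scalarq.
by rewrite hornerC horner_conj mul_quatL_conj.
Qed.

Lemma horner_size2 (A : {poly quat C}) z : (size A <= 2)%N ->
  A.[z%:A] = A`_0 + z *: A`_1.
Proof.
move=> sA; rewrite (horner_coef_wide _ sA) !big_ord_recl big_ord0 /=.
by rewrite expr0 mulr1 expr1 mul_scalarq addr0.
Qed.

Lemma conic_cone p : (conic_param p + conjq (conic_param p) = 0) /\
  (conic_param p * conjq (conic_param p) = 0).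
Proof. by rewrite conic_paramE; split; congr Quat => /=; ring: sqi. Qed.

(** A squared bracket is bilinear in the two Veronese vectors, hence blind to signs. *)
Lemma bracket_veronese p q p' q' : veronese p = veronese p' ->
  veronese q = veronese q' -> bracket p q ^+ 2 = bracket p' q' ^+ 2.
Proof.
move=> [e1 e2 e3] [f1 f2 f3].
transitivity (p.1 ^+ 2 * q.2 ^+ 2 - 2 * (p.1 * p.2) * (q.1 * q.2)
    + q.1 ^+ 2 * p.2 ^+ 2).
  by rewrite /bracket; ring.
by rewrite e1 e2 e3 f1 f2 f3 /bracket; ring.
Qed.

(** Since [conic_param] is homogeneous of degree two, a square root of the scalar moves into the
    parameter. *)
Lemma conic_point_sqrt (phi : quat C) p : conic_point phi p ->
  exists2 d, d != 0 & phi = conic_param (d * p.1, d * p.2).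
Proof.
move=> [_ [c c0 ->]].
have [d dE] : exists d, d ^+ 2 = c by exists (sqrtc c); exact: sqr_sqrtc.
exists d; first by rewrite -sqrf_eq0 dE.
by rewrite !conic_paramE -dE; congr Quat => /=; ring.
Qed.

Lemma bracket_line p q z w :
  bracket (line_point p q z) (line_point p q w) = (w - z) * bracket p q.
Proof. by rewrite /bracket /=; ring. Qed.

(** A line with dependent coefficients stays among the multiples of one vector. This turns
    nondegeneracy of [phi] into a nonzero bracket. *)
Lemma conic_param_collinear p q : bracket p q = 0 ->
  exists v, forall z, exists c, conic_param (line_point p q z) = c *: conic_param v.
Proof.
have [p0|p0] := eqVneq p (0, 0).
  exists q => z; exists (z ^+ 2); rewrite p0 !conic_paramE; congr Quat => /=; ring.
move=> e; exists p => z.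
have [c ->] : exists c, q = (c * p.1, c * p.2).
  case: p q p0 e => [x y] [x' y']; rewrite /bracket /= xpair_eqE negb_and => n e.
  have {}e : x * y' = x' * y by apply/subr0_eq.
  case/orP: n => n.
    by exists (x' / x); congr (_, _); [field | apply: (mulfI n); rewrite e; field].
  by exists (y' / y); congr (_, _); [apply: (mulIf n); rewrite -e; field | field].
by exists ((1 + z * c) ^+ 2); rewrite !conic_paramE; congr Quat => /=; ring.
Qed.
End Interpolation.

(** * Normalizing the rectangle *)

Section Rectangle.
Variables (R : realType) (r1 r2 : R) (P : 'I_4 -> R[i]).
Hypotheses (r1_gt0 : 0 < r1) (r2_gt0 : 0 < r2).
Hypotheses (rectP : anticlockwise_rectangle P).
Hypotheses (leg1 : `|P 1 - P 0| = r1%:C%C) (leg2 : `|P 3 - P 0| = r2%:C%C).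
Local Notation rho := (r1 +i* r2)%C.
Local Notation Re := complex.Re.
Local Notation Im := complex.Im.

(** The unit [e] is [(P 1 - P 0) / r1], the direction of the first leg. Orthogonality and
    orientation make the second leg its anticlockwise quarter turn, scaled by [r2]. *)
Lemma rectangle_nodes : exists (z : 'I_4 -> R[i]) (e : R[i]),
  [/\ e != 0, forall l, P l = P 0 + z l * e &
   [/\ z 0 = 0, z 1 = r1%:C%C, z 2 = rho & z 3 = 'i%C * r2%:C%C]].
Proof.
have [] := rectP; set u := P 1 - P 0; set v := P 3 - P 0 => P2 dot0 orient.
have sqr_leg w (r : R) : 0 < r -> `|w| = r%:C%C ->
    Re w ^+ 2 + Im w ^+ 2 = r ^+ 2.
  move=> r0; rewrite normc_def => /complexI <-.
  by rewrite sqr_sqrtr // addr_ge0 // sqr_ge0.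
have := sqr_leg _ _ r1_gt0 leg1; have := sqr_leg _ _ r2_gt0 leg2.
rewrite -/u -/v => Ev Eu.
(* Lagrange's identity gives the square of the area; the orientation gives its sign. *)
have area : Re u * Im v - Im u * Re v = r1 * r2.
  apply/eqP; rewrite -(@eqrXn2 _ 2) ?mulr_ge0 ?ltW //; apply/eqP.
  rewrite exprMn -Eu -Ev.
  transitivity ((Re u ^+ 2 + Im u ^+ 2) * (Re v ^+ 2 + Im v ^+ 2)
    - (Re u * Re v + Im u * Im v) ^+ 2); first by ring.
  by rewrite dot0; ring.
have n1 : r1 != 0 by rewrite gt_eqF.
have n2 : r2 != 0 by rewrite gt_eqF.
have n1C : r1%:C%C != 0 by rewrite (inj_eq (@complexI _) _ 0).
have turn : v = 'i%C * r2%:C%C * (u / r1%:C%C).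
  apply: (mulIf n1C); rewrite mulrA divfK //.
  (* [dot0] and [area] form a linear system in [v], of determinant [r1 ^+ 2]. *)
  have ec : r1 * Re v = - (r2 * Im u).
    apply: (mulfI n1); rewrite mulrA -expr2 -Eu.
    transitivity (Re u * (Re u * Re v + Im u * Im v)
      - Im u * (Re u * Im v - Im u * Re v)).
      by ring.
    by rewrite dot0 area; ring.
  have ed : r1 * Im v = r2 * Re u.
    apply: (mulfI n1); rewrite mulrA -expr2 -Eu.
    transitivity (Im u * (Re u * Re v + Im u * Im v)
      + Re u * (Re u * Im v - Im u * Re v)).
      by ring.
    by rewrite dot0 area; ring.
  move: ec ed; case: (u) => a b; case: (v) => c d /= ec ed; simpc.
  by rewrite mulrC ec [d * _]mulrC ed; congr Complex; ring.
have e0 : u / r1%:C%C != 0.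
  by rewrite mulf_neq0 ?invr_eq0 // -normr_eq0 leg1.
exists (fun l => (P l - P 0) / (u / r1%:C%C)), (u / r1%:C%C); split=> //.
  by move=> l; rewrite divfK // addrC subrK.
have u0 : u != 0 by apply: contraNneq e0 => ->; rewrite mul0r.
have z1 : u / (u / r1%:C%C) = r1%:C%C by field; rewrite n1C u0.
have z3 : v / (u / r1%:C%C) = 'i%C * r2%:C%C by rewrite turn mulfK.
split=> //; first by rewrite subrr mul0r.
rewrite P2 (_ : _ - _ = u + v); last by ring.
by rewrite mulrDl z1 z3 [RHS]complexE.
Qed.
End Rectangle.

(** * From vectors on the conic to brackets *)

(** Rescaling the parameters makes each [phi l] an exact value of [conic_param]. Every index occurs
    once in the numerator and once in the denominator, so both gain the same factor. *)
Lemma conic_cross_ratio_lift (R : realType) (phi : 'I_4 -> quat R[i]) (x : R[i]) :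
  conic_cross_ratio phi x ->
  exists q : 'I_4 -> R[i] * R[i],
    [/\ forall l, phi l = conic_param (q l), cross_ratio_den q != 0
      & cross_ratio_num q = x * cross_ratio_den q].
Proof.
move=> [p [onN den cr]].
have [d dn phiE] := fin_all_exists2 (fun l => conic_point_sqrt (onN l)).
pose q l := (d l * (p l).1, d l * (p l).2); exists q.
have bracketE k l : bracket (q k) (q l) = d k * d l * bracket (p k) (p l).
  by rewrite /bracket /q /=; ring.
split=> //.
  by rewrite /cross_ratio_den !bracketE mulrACA mulf_neq0 // !mulf_neq0.
rewrite -cr /cross_ratio /cross_ratio_num /cross_ratio_den !bracketE.
transitivity (d 0 * d 1 * d 2 * d 3 * cross_ratio_num p).
  by rewrite /cross_ratio_num; ring.
rewrite -[cross_ratio_num p](divfK den) /cross_ratio_num /cross_ratio_den.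
by ring.
Qed.

(** For fixed [q], the squared bracket is a linear form in [conic_param p]. If A, B, C are the [i],
    [j], [k] coordinates, twice that square is [q.2 ^+ 2 * (A - 'i * B) + q.1 ^+ 2 * (A + 'i * B) +
    2 * 'i * q.1 * q.2 * C]. *)
Lemma conic_relation_brackets (R : realType) (c0 c1 c2 c3 : R[i])
    (q0 q1 q2 q3 q : R[i] * R[i]) :
  c0 *: conic_param q0 + c1 *: conic_param q1
    - c2 *: conic_param q2 - c3 *: conic_param q3 = 0 ->
  c0 * bracket q0 q ^+ 2 + c1 * bracket q1 q ^+ 2
    - c2 * bracket q2 q ^+ 2 - c3 * bracket q3 q ^+ 2 = 0.
Proof.
rewrite !conic_paramE => -[_ hA hB hC].
have two_neq0 : 2 != 0 :> R[i] by rewrite pnatr_eq0.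
apply: (mulfI two_neq0); rewrite mulr0.
have <- : q.2 ^+ 2 * (0 - 'i%C * 0) + q.1 ^+ 2 * (0 + 'i%C * 0)
    + 2 * 'i%C * q.1 * q.2 * 0 = 0 :> R[i] by rewrite !(mulr0, subr0, addr0).
rewrite -{1 3}hA -{1 2}hB -hC /bracket.
by ring: (sqr_i R).
Qed.

(** * Both implications at the normalized nodes *)

Section Nodes.
Variables (R : realType) (r1 r2 rho rhob : R[i]).
Hypotheses (r1_neq0 : r1 != 0) (r2_neq0 : r2 != 0).
Hypotheses (rhoE : rho = r1 + 'i%C * r2) (rhobE : rhob = r1 - 'i%C * r2).
Hypotheses (rho_neq0 : rho != 0) (rhob_neq0 : rhob != 0).
Variables (P z : 'I_4 -> R[i]) (e : R[i]).
Hypotheses (e_neq0 : e != 0) (PE : forall l, P l = P 0 + z l * e).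
Hypotheses (z0 : z 0 = 0) (z1 : z 1 = r1) (z2 : z 2 = rho) (z3 : z 3 = 'i%C * r2).

Let sqi : 'i%C ^+ 2 = -1 :> R[i] := sqr_i R.

Let i_neq0 : 'i%C != 0 :> R[i].
Proof. by rewrite -sqrf_eq0 sqi oppr_eq0 oner_eq0. Qed.

Lemma cross_ratio_nodes :
  cross_ratio (fun l => (P l, 1)) = rho * rhob / r2 ^+ 2.
Proof.
have d12 : P 1 - P 2 = - ('i%C * r2 * e) by rewrite (PE 1) (PE 2) z1 z2 rhoE; ring.
have d03 : P 0 - P 3 = - ('i%C * r2 * e) by rewrite (PE 3) z3; ring.
rewrite cross_ratio_affine d12 d03 (PE 1) (PE 2) (PE 3) z1 z2 z3 rhoE rhobE.
by field: sqi; rewrite r2_neq0 e_neq0 i_neq0.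
Qed.

(** The values are quadratic in the node, and the four weights annihilate 1, [z l] and
    [z l ^+ 2]. *)
Lemma line_relation (a b : R[i] * R[i]) :
  let phi l := conic_param (line_point a b (z l)) in
  rho * rhob *: phi 0 + rho ^+ 2 *: phi 1
    - rho * rhob *: phi 2 - rho ^+ 2 *: phi 3 = 0.
Proof.
rewrite /= !conic_paramE z0 z1 z2 z3 /line_point /= rhoE rhobE.
by congr Quat => /=; ring: sqi.
Qed.

(** By [bracket_line], brackets on the line are node differences times [bracket a b], a factor that
    cancels in the cross-ratio. *)
Lemma line_cross_ratio (a b : R[i] * R[i]) : bracket a b != 0 ->
  conic_cross_ratio (fun l => conic_param (line_point a b (z l)))
    (cross_ratio (fun l => (P l, 1))).
Proof.
move=> ab; exists (fun l => line_point a b (z l)); split.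
- move=> l; split; last by exists 1; rewrite ?oner_eq0 ?scale1r.
  apply: contraNneq ab => ab0.
  have <- : bracket (line_point a b (z l)) b = bracket a b.
    by rewrite /bracket /=; ring.
  by rewrite ab0 /bracket /= mul0r mulr0 subrr.
- rewrite /cross_ratio_den !bracket_line z0 z1 z2 z3 rhoE.
  by rewrite [r1 + _]addrC addrK subr0 !mulf_neq0.
- rewrite cross_ratio_nodes /cross_ratio /cross_ratio_den /cross_ratio_num.
  rewrite !bracket_line z0 z1 z2 z3 rhoE rhobE.
  rewrite [r1 + _ - r1]addrAC subrr add0r.
  by field: sqi; rewrite r2_neq0 ab i_neq0.
Qed.

Lemma line_of_relation (phi : 'I_4 -> quat R[i]) :
  rho * rhob *: phi 0 + rho ^+ 2 *: phi 1
    - rho * rhob *: phi 2 - rho ^+ 2 *: phi 3 = 0 ->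
  conic_cross_ratio phi (cross_ratio (fun l => (P l, 1))) ->
  exists a b : R[i] * R[i],
    b != (0, 0) /\ forall l, phi l = conic_param (line_point a b (z l)).
Proof.
rewrite cross_ratio_nodes => rel /conic_cross_ratio_lift[q [phiE den num]].
have two_neq0 : 2 != 0 :> R[i] by rewrite pnatr_eq0.
have cr : r2 ^+ 2 * cross_ratio_num q = rho * rhob * cross_ratio_den q.
  by rewrite num mulrA [r2 ^+ 2 * _]mulrC divfK // expf_neq0.
have rel_bracket v : rhob * bracket (q 0) v ^+ 2 + rho * bracket (q 1) v ^+ 2
    - rhob * bracket (q 2) v ^+ 2 - rho * bracket (q 3) v ^+ 2 = 0.
  (* Dividing the relation by [rho] leaves the weights [rhob] and [rho]. *)
  apply: (mulfI rho_neq0); rewrite mulr0.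
  move: rel; rewrite !phiE => /(@conic_relation_brackets _ _ _ _ _ _ _ _ _ v) <-.
  by ring.
have [a [b [v0 v1 v2 v3]]] :=
  interpolate_up_to_sign sqi two_neq0 r1_neq0 r2_neq0 rhoE rhobE
    rho_neq0 rhob_neq0 rel_bracket cr den.
exists a, b; split.
  (* If [b] vanished, the points of index 1 and 2 would coincide up to sign, and so would their
     bracket vanish. The square is taken because [v1] and [v2] hold only up to sign. *)
  apply: contraNneq den => b0; rewrite /cross_ratio_den -sqrf_eq0 exprMn.
  rewrite (bracket_veronese v1 v2) bracket_line b0 /bracket /=.
  by rewrite !(mulr0, mul0r, subr0, expr0n).
apply: forall_ord4; rewrite phiE; apply: conic_param_veronese.
- by rewrite v0 z0 /line_point !mul0r !addr0.
- by rewrite v1 z1.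
- by rewrite v2 z2.
- by rewrite v3 z3.
Qed.
End Nodes.

(** * Building the polynomial, and the equivalence *)

Lemma size2_poly_exists (S : nzRingType) (c0 c1 : S) : c1 != 0 ->
  exists A : {poly S}, [/\ size A = 2%N, A`_0 = c0 & A`_1 = c1].
Proof.
move=> c1_neq0; exists (c1%:P * 'X + c0%:P).
rewrite size_MXaddC polyC_eq0 size_polyC (negPf c1_neq0) !coefD !coefMX !coefC.
by rewrite /= add0r addr0.
Qed.

(** [Quat x y 0 0] is a preimage of (x, y) under [spinor]. The coefficients undo the substitution of
    [p + z * e], and [b != (0, 0)] makes the degree exactly one. *)
Lemma interpolating_polynomial (R : realType) (p e : R[i]) (a b : R[i] * R[i]) :
  e != 0 -> b != (0, 0) ->
  exists A : {poly quat R[i]}, size A = 2%N /\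
    forall z, (isotropic_poly A).[(p + z * e)%:A] = conic_param (line_point a b z).
Proof.
move=> e_neq0 b_neq0.
have B_neq0 : Quat (b.1 / e) (b.2 / e) 0 0 != 0.
  apply: contraNneq b_neq0 => -[/eqP + /eqP].
  rewrite !mulf_eq0 invr_eq0 (negPf e_neq0) !orbF => /eqP b1 /eqP b2.
  by rewrite [b]surjective_pairing b1 b2.
have [A [sA cA0 cA1]] := size2_poly_exists
  (Quat (a.1 - p * (b.1 / e)) (a.2 - p * (b.2 / e)) 0 0) B_neq0.
exists A; split=> // z; have sA' : (size A <= 2)%N by rewrite sA.
rewrite horner_isotropic (horner_size2 _ sA') cA0 cA1.
congr conic_param; rewrite /spinor /line_point /=.
by congr (_, _); field.
Qed.

Theorem theorem5p2 (R : realType) (r1 r2 : R) (P : 'I_4 -> R[i])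
    (phi : 'I_4 -> quat R[i])
    (r1_gt0 : 0 < r1) (r2_gt0 : 0 < r2)
    (rectP : anticlockwise_rectangle P)
    (leg1 : `|P 1 - P 0| = r1%:C%C) (leg2 : `|P 3 - P 0| = r2%:C%C)
    (phi_nondeg : ~ all_proportional phi) :
  let rho : R[i] := (r1 +i* r2)%C in
  (exists A : {poly quat R[i]},
     size A = 2%N /\ forall l, (isotropic_poly A).[(P l)%:A] = phi l)
  <->
  [/\ forall l, phi l + conjq (phi l) = 0 /\ phi l * conjq (phi l) = 0,
      `|rho| ^+ 2 *: phi 0 + rho ^+ 2 *: phi 1
        - `|rho| ^+ 2 *: phi 2 - rho ^+ 2 *: phi 3 = 0
    & conic_cross_ratio phi (cross_ratio (fun l => (P l, 1)))].
Proof.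
have [z [e [e_neq0 PE [z0 z1 z2 z3]]]] :=
  rectangle_nodes r1_gt0 r2_gt0 rectP leg1 leg2.
move=> rho; rewrite -/rho in z2; set rhob := (r1 -i* r2)%C.
have r1_neq0 : r1%:C%C != 0 :> R[i] by rewrite (inj_eq (@complexI _) _ 0) gt_eqF.
have r2_neq0 : r2%:C%C != 0 :> R[i] by rewrite (inj_eq (@complexI _) _ 0) gt_eqF.
have rhoE : rho = r1%:C%C + 'i%C * r2%:C%C by rewrite [LHS]complexE.
have rhobE : rhob = r1%:C%C - 'i%C * r2%:C%C.
  by rewrite [LHS]complexE /= rmorphN mulrN.
have rho_neq0 : rho != 0 by rewrite eq_complex /= gt_eqF.
have rhob_neq0 : rhob != 0 by rewrite eq_complex /= gt_eqF.
have -> : `|rho| ^+ 2 = rho * rhob by exact: sqr_normc.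
clearbody rho rhob; split.
  move=> [A [sA phiE]].
  (* Expanding [A] around [P 0] with step [e] makes its spinor affine in the node [z l]. *)
  have {}phiE l : phi l
      = conic_param (line_point (spinor A.[(P 0)%:A]) (spinor (e *: A`_1)) (z l)).
    rewrite -phiE horner_isotropic -spinor_line !horner_size2 ?sA // (PE l).
    by rewrite scalerA -addrA -scalerDl.
  move: phiE; set a := spinor _; set b := spinor _; move=> phiE.
  have ab_neq0 : bracket a b != 0.
    apply/negP => /eqP/conic_param_collinear[v colv].
    case: phi_nondeg; exists (conic_param v) => l.
    by have [c cE] := colv (z l); exists c; rewrite phiE.
  split.
  - by move=> l; rewrite phiE; exact: conic_cone.
  - rewrite !phiE; exact: (line_relation rhoE rhobE z0 z1 z2 z3).
  - have [p [onN den cr]] := line_cross_ratio r2_neq0 rhoE rhobE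
      e_neq0 PE z0 z1 z2 z3 ab_neq0.
    by exists p; split=> // l; rewrite phiE.
move=> [_ rel cr].
have [a [b [b_neq0 phiE]]] := line_of_relation r1_neq0 r2_neq0 rhoE rhobE
  rho_neq0 rhob_neq0 e_neq0 PE z0 z1 z2 z3 rel cr.
have [A [sA AE]] := interpolating_polynomial (P 0) a e_neq0 b_neq0.
by exists A; split=> // l; rewrite PE AE -phiE.
Qed.
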